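(* Let $f\colon\mathbb N\to\mathbb U$ be a multiplicative function with $f\sim\chi$ for some primitive Dirichlet character $\chi$ with conductor $q$. Suppose that either (i) $\alpha$ is irrational, or (ii) $\alpha=k/p$, where $p$ is a prime, $(k,p)=1$, $p\nmid q$, and $f(p^s)=\chi(p^s)$ for every $s\in\mathbb N$. Then $$\lim_{N\to\infty}\mathbb E_{n\in[N]}\,e(n\alpha)\prod_{j=1}^\ell f_j(n+n_j)=0$$ for all $\ell\in\mathbb N$, $n_1,\ldots,n_\ell\in\mathbb Z$ and $f_1,\ldots,f_\ell\in\{f,\overline f\}$.
   Context: $\mathbb N=\{1,2,\ldots\}$, $\mathbb P$ is the set of primes, $\mathbb U$ is the closed complex unit disc, $e(t)=e^{2\pi i t}$, $[N]=\{1,\ldots,N\}$, $\mathbb E_{n\in[N]}a(n)=\frac1N\sum_{n=1}^Na(n)$. A function $f\colon\mathbb N\to\mathbb U$ is multiplicative if $f(mn)=f(m)f(n)$ whenever $(m,n)=1$; $f$ is extended to $\mathbb Z$ with values in $\mathbb U$ in an arbitrary way (this does not affect the limit). For multiplicative $f,g\colon\mathbb N\to\mathbb U$ let $\mathbb D^2(f,g)=\sum_{p\in\mathbb P}\frac1p\big(1-\mathrm{Re}(f(p)\overline{g(p)})\big)$ and write $f\sim g$ if $\mathbb D(f,g)<+\infty$. The constant $\chi=1$ is regarded as a primitive Dirichlet character with conductor $q=1$. *)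

(* Defs.v *)
From mathcomp Require Import all_boot all_order all_algebra.
From mathcomp Require Import all_classical all_reals all_analysis.
From mathcomp Require Import complex.

Set Implicit Arguments.
Unset Strict Implicit.
Unset Printing Implicit Defensive.

Import Order.TTheory GRing.Theory Num.Theory.
Import numFieldNormedType.Exports.

Local Open Scope classical_set_scope.
Local Open Scope ring_scope.
Local Open Scope complex_scope.

(* Arithmetic functions live on [int]: functions on {1, 2, ...} with values in
   the closed unit disc are represented by one of their extensions to the
   integers, and the predicates below only look at positive arguments, except
   [bounded_by_one] and [dirichlet_character]. *)

Definition bounded_by_one (R : realType) (f : int -> R[i]) : Prop :=
  forall n : int, `|f n| <= 1.

Definition multiplicative_fun (R : realType) (f : int -> R[i]) : Prop :=
  forall m n : nat, (0 < m)%N -> (0 < n)%N -> coprime m n ->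
    f (m * n)%N%:Z = f m%:Z * f n%:Z.

(* For q = 1 these clauses force chi to be the constant 1, since every integer
   (including 0) is coprime to 1. *)
Definition dirichlet_character (R : realType) (q : nat) (chi : int -> R[i]) :
    Prop :=
  [/\ (0 < q)%N,
      forall m n : int, chi (m * n) = chi m * chi n,
      forall n : int, chi (n + q%:Z) = chi n &
      forall n : int, (chi n != 0) = coprimez n q%:Z].

(* chi is not induced by a character of smaller modulus; its modulus q is then
   its conductor. *)
Definition primitive_character (R : realType) (q : nat) (chi : int -> R[i]) :
    Prop :=
  dirichlet_character q chi /\
  forall (d : nat) (psi : int -> R[i]),
    (d %| q)%N -> dirichlet_character d psi ->
    (forall n : int, coprimez n q%:Z -> chi n = psi n) -> d = q.

(* The terms are nonnegative as soon as f and g take values in the unit disc. *)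
Definition pretentious_dist2 (R : realType) (f g : int -> R[i]) : \bar R :=
  (\sum_(0 <= p <oo | prime p)
     (p%:R^-1 * (1 - complex.Re (f p%:Z * (g p%:Z)^*)))%:E)%E.

Definition pretentious_dist (R : realType) (f g : int -> R[i]) : \bar R :=
  sqrte (pretentious_dist2 f g).

Definition pretends_to_be (R : realType) (f g : int -> R[i]) : Prop :=
  (pretentious_dist f g < +oo)%E.

(* e(t) = exp(2 pi i t) *)
Definition expi2pi (R : realType) (t : R) : R[i] :=
  cos (2 * pi * t) +i* sin (2 * pi * t).

(* The average of a(1), ..., a(N); the junk value at N = 0 is 0. *)
Definition average (R : realType) (N : nat) (a : nat -> R[i]) : R[i] :=
  N%:R^-1 * \sum_(1 <= n < N.+1) a n.

(* Main.v *)
Require Import Defs.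
From mathcomp Require Import all_boot all_order all_algebra.
From mathcomp Require Import all_classical all_reals all_analysis.
From mathcomp Require Import complex ring lra cyclic.

Import Order.TTheory GRing.Theory Num.Theory.
Import numFieldNormedType.Exports.
Import Normc.

Set Implicit Arguments.
Unset Strict Implicit.
Unset Printing Implicit Defensive.

Local Open Scope classical_set_scope.
Local Open Scope ring_scope.
Local Open Scope complex_scope.

(** On [[1, N]] the function [f] is close in the mean to [c * P], where [c] is a
    constant of modulus at most 1 and [P] is periodic
    ([pretentious_approximation]). A product of shifts of such functions and of
    their conjugates is again a constant times a periodic function, and the
    exponential sums of a function of period [M] at the frequency [alpha] stay
    bounded unless [M * alpha] is an integer ([periodic_exponential_sum_le]).
    The constant [c] may depend on [N], because the phase of [f] may drift with
    the scale, but it only multiplies a quantity that tends to 0.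

    To approximate [f], fix a large [K] and split [n = d * m], where [d] is the
    part of [n] built from primes at most [K]. A high power of a small prime, or
    the square of a large prime, rarely divides [n]; otherwise [d] is a gcd with
    a fixed modulus, so that [P n = f d * chi (n / d)] is periodic, and
    [f n = P n * h n], where [h n] is the product over the large primes [r]
    dividing [n] of the ratios [z r = f r * conj (chi r)]
    ([multiplicative_model]). If [f] and [chi] agree on the powers of a prime
    [p], then that prime need not be put in [d], so the period may be taken
    prime to [p] when the conductor is; this is what makes a frequency [k / p]
    admissible ([nonresonant_period]).

    It remains to see that [h] is nearly constant
    ([prime_product_concentration]). Pretentiousness makes the sum of
    [(1 - Re (z r)) / r] over the large primes small, hence also that of
    [Im (z r) ^ 2 / r]. Replacing [z r] by the unit vector of angle [Im (z r)]
    turns [h] into the exponential of an additive function, whose variance is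
    small by the Turan-Kubilius inequality. That inequality is applied only to
    the primes up to [sqrt N]: there the rounding errors are controlled by
    Cauchy-Schwarz alone, and at most one prime above [sqrt N] divides a given
    [n <= N]. So no estimate on the distribution of primes enters. *)

(** * Complex numbers of modulus at most one *)

Lemma normc_norm (R : realType) (z : R[i]) : `|z| = (normc z)%:C.
Proof. by []. Qed.

Lemma normc_ge0 (R : realType) (z : R[i]) : 0 <= normc z.
Proof. by case: z => a b; exact: sqrtr_ge0. Qed.

Lemma normcJ (R : realType) (z : R[i]) : normc z^* = normc z.
Proof. by apply: complexI; rewrite -!normc_norm normcJ. Qed.

Lemma normc_sqr (R : realType) (z : R[i]) :
  normc z ^+ 2 = complex.Re z ^+ 2 + complex.Im z ^+ 2.
Proof. by case: z => a b; rewrite sqr_sqrtr// addr_ge0 ?sqr_ge0. Qed.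

Lemma normc_le_ReIm (R : realType) (z : R[i]) :
  normc z <= `|complex.Re z| + `|complex.Im z|.
Proof.
rewrite -ler_sqr ?nnegrE ?normc_ge0 ?addr_ge0// normc_sqr.
rewrite sqrrD !real_normK ?num_real//.
have : 0 <= `|complex.Re z| * `|complex.Im z| *+ 2 by rewrite mulrn_wge0 ?mulr_ge0.
lra.
Qed.

Lemma Re_le_normc (R : realType) (z : R[i]) : complex.Re z <= normc z.
Proof.
have := normc_ge_Re z; rewrite normc_norm lecR; apply: le_trans.
exact: ler_norm.
Qed.

Lemma normcB_le (R : realType) (x y z : R[i]) :
  normc (x - z) <= normc (x - y) + normc (y - z).
Proof. by rewrite -[x - z](subrKA y) (le_trans (le_normcD _ _))// addrC. Qed.

Lemma normc_distC (R : realType) (x y : R[i]) : normc (x - y) = normc (y - x).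
Proof. by rewrite -normcN opprB. Qed.

Lemma normc_sum (R : realType) (I : Type) (s : seq I) (P : pred I)
    (F : I -> R[i]) :
  normc (\sum_(i <- s | P i) F i) <= \sum_(i <- s | P i) normc (F i).
Proof.
elim/big_rec2: _ => [|i x y _ h]; first by rewrite normc0.
by rewrite (le_trans (le_normcD _ _))// lerD2l.
Qed.

Lemma normc_prod_le1 (R : realType) (I : Type) (s : seq I) (P : pred I)
    (F : I -> R[i]) :
  (forall i, normc (F i) <= 1) -> normc (\prod_(i <- s | P i) F i) <= 1.
Proof.
move=> F1; elim/big_rec: _ => [|i x _ h]; first by rewrite normc1.
by rewrite normcM mulr_ile1 ?normc_ge0.
Qed.

Lemma normc_mul_dist (R : realType) (a b c d : R[i]) :
  normc b <= 1 -> normc c <= 1 ->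
  normc (a * b - c * d) <= normc (a - c) + normc (b - d).
Proof.
move=> b1 c1; have -> : a * b - c * d = (a - c) * b + c * (b - d) by ring.
rewrite (le_trans (le_normcD _ _))// !normcM lerD//.
  by rewrite ler_piMr ?normc_ge0.
by rewrite ler_piMl ?normc_ge0.
Qed.

Lemma normc_prod_dist (R : realType) (I : Type) (s : seq I) (P : pred I)
    (F G : I -> R[i]) :
  (forall i, normc (F i) <= 1) -> (forall i, normc (G i) <= 1) ->
  normc (\prod_(i <- s | P i) F i - \prod_(i <- s | P i) G i)
    <= \sum_(i <- s | P i) normc (F i - G i).
Proof.
move=> F1 G1; elim: s => [|i s IH]; first by rewrite !big_nil subrr normc0.
rewrite !big_cons; case: ifP => // Pi.
apply: le_trans (normc_mul_dist _ _ _ _) _ => //; last by rewrite lerD2l.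
exact: normc_prod_le1.
Qed.

(** * Points of the unit circle *)

Definition cis (R : realType) (x : R) : R[i] := cos x +i* sin x.

Lemma normc_cis (R : realType) (x : R) : normc (cis x) = 1.
Proof. by rewrite /normc /= cos2Dsin2 sqrtr1. Qed.

Lemma cisD (R : realType) (x y : R) : cis (x + y) = cis x * cis y.
Proof. by apply/eqP; rewrite eq_complex /= cosD sinD [sin x * _ + _]addrC !eqxx. Qed.

Lemma cis0 (R : realType) : cis (0 : R) = 1.
Proof. by apply/eqP; rewrite eq_complex /= cos0 sin0 !eqxx. Qed.

Lemma cis_sum (R : realType) (I : Type) (s : seq I) (P : pred I) (F : I -> R) :
  cis (\sum_(i <- s | P i) F i) = \prod_(i <- s | P i) cis (F i).
Proof. by rewrite (big_morph (@cis R) (@cisD R) (cis0 R)). Qed.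

Lemma sin_sqr_le (R : realType) (t : R) : sin t ^+ 2 <= t ^+ 2.
Proof.
wlog t0 : t / 0 <= t.
  move=> h; have [/h//|/ltW t0] := leP 0 t.
  by have := h (- t); rewrite sinN !sqrrN oppr_ge0; apply.
have [c _] := @MVT_segment R sin cos 0 t t0 (fun x _ => is_derive_sin x)
  (continuous_subspaceT (@continuous_sin R)).
rewrite sin0 !subr0 => ->; rewrite exprMn ler_piMl ?sqr_ge0//.
Qed.

Lemma cos_ge_quad (R : realType) (t : R) : 1 - t ^+ 2 / 2 <= cos t.
Proof.
have -> : t = (t / 2) *+ 2 by rewrite -mulr_natr divfK.
rewrite cos_mulr2n; have := sin_sqr_le (t / 2); have := cos2Dsin2 (t / 2).
set a := t / 2; have -> : (a *+ 2) ^+ 2 / 2 = 2 * a ^+ 2 by field.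
lra.
Qed.

Lemma cis_dist (R : realType) (x y : R) :
  normc (cis x - cis y) <= `|x - y|.
Proof.
rewrite -ler_sqr ?nnegrE ?normc_ge0// normc_sqr real_normK ?num_real//=.
have := cos_ge_quad (x - y); rewrite cosB.
have := cos2Dsin2 x; have := cos2Dsin2 y; lra.
Qed.

Lemma sin_near_id (R : realType) (b : R) :
  `|b| <= 1 -> `|sin b - b| <= b ^+ 2 / 2.
Proof.
wlog b0 : b / 0 <= b.
  move=> h; have [/h//|/ltW b0] := leP 0 b => b1.
  have := h (- b); rewrite sinN sqrrN normrN oppr_ge0 => /(_ b0 b1).
  by rewrite -opprD normrN.
rewrite ger0_norm// => b1.
have [|c] := @MVT_segment R (fun x => sin x - x) (fun x => cos x - 1) 0 b b0.
  by apply: continuous_subspaceT => x; apply: cvgB => //; exact: continuous_sin.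
rewrite sin0 !subr0 in_itv/= => /andP[c0 cb] ->.
rewrite normrM [`|b|]ger0_norm// distrC ger0_norm ?subr_ge0 ?cos_le1//.
have cb2 : c ^+ 2 <= b ^+ 2 by rewrite ler_sqr ?nnegrE.
have h : 1 - cos c <= b ^+ 2 / 2 by have := cos_ge_quad c; lra.
by rewrite (le_trans _ h)// ler_piMr// subr_ge0 cos_le1.
Qed.

(** Both the defect [1 - Re z] and the square of [Im z] measure how far [z] is
    from 1, and the unit disc makes the second at most twice the first; so a
    point of the disc differs from the unit vector with angle [Im z] by an
    amount linear in the defect. *)
Lemma cis_Im_dist (R : realType) (z : R[i]) :
  normc z <= 1 -> normc (z - cis (complex.Im z)) <= 3 * (1 - complex.Re z).
Proof.
move=> z1; have a1 := le_trans (Re_le_normc z) z1.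
have := normc_sqr z; have : normc z ^+ 2 <= 1 by rewrite expr_le1 ?normc_ge0.
move=> /[swap] -> ab1; apply: le_trans (normc_le_ReIm _) _.
case: z z1 a1 ab1 => a b z1 /= a1 ab1.
have a2 : 2 * a - 1 <= a ^+ 2 by have := sqr_ge0 (a - 1); lra.
have b2 : b ^+ 2 <= 2 * (1 - a) by lra.
have b1 : `|b| <= 1.
  rewrite -ler_sqr ?nnegrE// real_normK ?num_real// expr1n.
  by have := sqr_ge0 a; lra.
have := sin_near_id b1; rewrite distrC.
have : `|a - cos b| <= 2 * (1 - a).
  by have := cos_ge_quad b; have := cos_le1 b; rewrite ler_norml; lra.
lra.
Qed.

Lemma Im_sqr_le (R : realType) (z : R[i]) :
  normc z <= 1 -> complex.Im z ^+ 2 <= 2 * (1 - complex.Re z).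
Proof.
move=> z1; have := normc_sqr z.
have : normc z ^+ 2 <= 1 by rewrite expr_le1 ?normc_ge0.
have := sqr_ge0 (complex.Re z - 1); lra.
Qed.

Lemma normc_1B_sqr_le (R : realType) (z : R[i]) :
  normc z <= 1 -> normc (1 - z) ^+ 2 <= 2 * (1 - complex.Re z).
Proof.
move=> z1; have := normc_sqr z; have : normc z ^+ 2 <= 1.
  by rewrite expr_le1 ?normc_ge0.
by rewrite !normc_sqr; case: z z1 => a b _ /=; lra.
Qed.

(** * A truncated Turan-Kubilius inequality *)

Lemma sum_dvdn (R : realType) (N d : nat) :
  \sum_(1 <= n < N.+1) (d %| n)%:R = (N %/ d)%:R :> R.
Proof. by rewrite divn_count_dvd natr_sum. Qed.

Lemma divn_natr_bounds (R : realType) (N d : nat) : (0 < d)%N ->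
  (N %/ d)%:R <= N%:R / d%:R :> R /\ N%:R / d%:R <= (N %/ d)%:R + 1 :> R.
Proof.
move=> d0; have d0' : 0 < d%:R :> R by rewrite ltr0n.
split; first by rewrite ler_pdivlMr// -natrM ler_nat leq_divM.
by rewrite ler_pdivrMr// natr1 -natrM ler_nat ltnW// ltn_ceil.
Qed.

Lemma sum_const_range (R : realType) (N : nat) (a : R) :
  \sum_(1 <= n < N.+1) a = N%:R * a.
Proof. by rewrite sumr_const_nat subn1 /= mulr_natl. Qed.

Lemma sum_dvdn_cross_le (R : realType) (N r t : nat) :
  prime r -> prime t -> r != t ->
  `|\sum_(1 <= n < N.+1)
      ((r %| n)%:R - r%:R^-1) * ((t %| n)%:R - t%:R^-1)| <= 1 :> R.
Proof.
move=> pr pt rt.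
have crt : coprime r t by rewrite prime_coprime// dvdn_prime2.
have -> : \sum_(1 <= n < N.+1)
      ((r %| n)%:R - r%:R^-1) * ((t %| n)%:R - t%:R^-1) =
   (N %/ (r * t))%:R - (N %/ r)%:R / t%:R - (N %/ t)%:R / r%:R
     + N%:R * (r%:R^-1 / t%:R) :> R.
  rewrite -!sum_dvdn -sum_const_range !mulr_suml -!sumrB -big_split /=.
  apply: eq_bigr => n _; rewrite Gauss_dvd// -mulnb natrM; ring.
have r0 : (0 < r)%N := prime_gt0 pr.
have t0 : (0 < t)%N := prime_gt0 pt.
have [a1 a2] := @divn_natr_bounds R N r r0.
have [b1 b2] := @divn_natr_bounds R N t t0.
have [|c1 c2] := @divn_natr_bounds R N (r * t); first by rewrite muln_gt0 r0.
rewrite natrM in c1 c2.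
have half (p : nat) : prime p -> (0 : R) < p%:R^-1 /\ p%:R^-1 <= 2^-1 :> R.
  move=> pp; split; first by rewrite invr_gt0 ltr0n prime_gt0.
  by rewrite lef_pV2 ?posrE ?ltr0n ?prime_gt0// ler_nat prime_gt1.
have [ir0 ir1] := half r pr; have [it0 it1] := half t pt.
move: a1 a2 b1 b2 c1 c2; rewrite invfM.
move: (N %/ (r * t))%:R (N %/ r)%:R (N %/ t)%:R (N%:R : R) ir0 ir1 it0 it1.
move: (r%:R^-1) (t%:R^-1) => u v D A B M u0 u1 v0 v1 a1 a2 b1 b2 c1 c2.
(* Each rounding error [M * u - A], [M * v - B] lies in [[0, 1]]. *)
have ha1 : 0 <= (M * u - A) * v by rewrite mulr_ge0 ?subr_ge0// ltW.
have ha2 : (M * u - A) * v <= v by rewrite ler_piMl ?lerBlDl// ltW.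
have hb1 : 0 <= (M * v - B) * u by rewrite mulr_ge0 ?subr_ge0// ltW.
have hb2 : (M * v - B) * u <= u by rewrite ler_piMl ?lerBlDl// ltW.
rewrite ler_norml; apply/andP; split; lra.
Qed.

Lemma sum_dvdn_diag_le (R : realType) (N r : nat) : prime r ->
  \sum_(1 <= n < N.+1) ((r %| n)%:R - r%:R^-1) ^+ 2 <= N%:R / r%:R :> R.
Proof.
move=> pr; have -> : \sum_(1 <= n < N.+1) ((r %| n)%:R - r%:R^-1) ^+ 2 =
    (N %/ r)%:R * (1 - 2 / r%:R) + N%:R * r%:R^-1 ^+ 2 :> R.
  rewrite -sum_dvdn -(sum_const_range N) mulr_suml -big_split /=.
  by apply: eq_bigr => n _; case: (r %| n)%N => /=; ring.
have [a1 _] := @divn_natr_bounds R N r (prime_gt0 pr).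
have r0 : 0 < r%:R :> R by rewrite ltr0n prime_gt0.
have h : 0 <= 1 - 2 / r%:R :> R.
  by rewrite subr_ge0 ler_pdivrMr// mul1r ler_nat prime_gt1.
have := ler_wpM2r h a1; have : 0 <= N%:R * r%:R^-1 ^+ 2 :> R.
  by rewrite mulr_ge0 ?sqr_ge0.
lra.
Qed.

Lemma sum_uniq_bounded (R : realType) (m : nat) (s : seq nat) :
  uniq s -> (forall r, r \in s -> (0 < r <= m)%N) ->
  \sum_(r <- s) r%:R <= (m * m)%:R :> R.
Proof.
move=> us sm; rewrite -natr_sum ler_nat.
apply: (@leq_trans (\sum_(r <- s) m)).
  by rewrite !big_seq; apply: leq_sum => r /sm /andP[].
rewrite big_const_seq count_predT iter_addn_0 mulnC leq_mul2r.
rewrite -[X in (_ <= X)%N](size_iota 1 m) uniq_leq_size ?orbT// => r /sm.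
by rewrite mem_iota add1n ltnS.
Qed.

(** Off the diagonal the events [r %| n] and [t %| n] are independent up to
    rounding, so their covariance summed over [n <= N] is at most 1. Keeping the
    primes at most [sqrt N] makes the sum of all these rounding errors
    [O(N)] by Cauchy-Schwarz, with no information on the density of primes. *)
Lemma turan_kubilius (R : realType) (N m : nat) (s : seq nat) (y : nat -> R) :
  uniq s -> (m * m <= N)%N -> (forall r, r \in s -> prime r) ->
  (forall r, r \in s -> (r <= m)%N) ->
  \sum_(1 <= n < N.+1) (\sum_(r <- s) y r * ((r %| n)%:R - r%:R^-1)) ^+ 2
    <= 2 * N%:R * \sum_(r <- s) y r ^+ 2 / r%:R.
Proof.
move=> us mN ps sm.
pose C r t : R :=
  \sum_(1 <= n < N.+1) ((r %| n)%:R - r%:R^-1) * ((t %| n)%:R - t%:R^-1).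
have -> : \sum_(1 <= n < N.+1)
      (\sum_(r <- s) y r * ((r %| n)%:R - r%:R^-1)) ^+ 2
    = \sum_(r <- s) \sum_(t <- s) y r * y t * C r t.
  under eq_bigr => n _ do rewrite expr2 big_distrlr /=.
  rewrite exchange_big /=; apply: eq_bigr => r _.
  rewrite exchange_big /=; apply: eq_bigr => t _.
  by rewrite mulr_sumr; apply: eq_bigr => n _; ring.
pose b r t : R := y r ^+ 2 / r%:R * t%:R.
(* The weights [t / r] and [r / t] split the off-diagonal terms so that the
   double sum factors. *)
apply: (@le_trans _ _ (\sum_(r <- s) \sum_(t <- s)
   ((b r t + b t r) / 2 + (t == r)%:R * (y r ^+ 2 * (N%:R / r%:R))))).
  rewrite big_seq [leRHS]big_seq; apply: ler_sum => r rs.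
  rewrite big_seq [leRHS]big_seq; apply: ler_sum => t ts.
  have b0 p u : 0 <= b p u by rewrite /b mulr_ge0// mulr_ge0 ?sqr_ge0.
  have [->|tr] := eqVneq t r.
    rewrite mul1r -[y r * y r]expr2 -[leLHS]add0r lerD//.
      by rewrite divr_ge0// addr_ge0.
    rewrite ler_wpM2l ?sqr_ge0//; apply: le_trans (sum_dvdn_diag_le _ N (ps _ rs)).
    by apply: ler_sum => n _; rewrite expr2.
  rewrite mul0r addr0; apply: le_trans (ler_norm _) _.
  rewrite normrM (le_trans (ler_piMr _ _))//.
    by apply: sum_dvdn_cross_le; rewrite ?ps// eq_sym.
  have r0 : 0 < r%:R :> R by rewrite ltr0n prime_gt0 ?ps.
  have t0 : 0 < t%:R :> R by rewrite ltr0n prime_gt0 ?ps.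
  rewrite normrM -(ler_pM2l (mulr_gt0 r0 t0)).
  have -> : r%:R * t%:R * ((b r t + b t r) / 2) =
      ((`|y r| * t%:R) ^+ 2 + (`|y t| * r%:R) ^+ 2) / 2 :> R.
    rewrite !exprMn !real_normK ?num_real// /b; field.
    by rewrite !lt0r_neq0.
  have := sqr_ge0 (`|y r| * t%:R - `|y t| * r%:R); lra.
under eq_bigr => r _ do rewrite big_split /= -mulr_suml.
rewrite big_split /= -mulr_suml.
have -> : \sum_(r <- s) \sum_(t <- s) (b r t + b t r)
    = 2 * ((\sum_(r <- s) y r ^+ 2 / r%:R) * \sum_(t <- s) t%:R).
  rewrite big_distrlr /= -/b.
  under eq_bigr => r _ do rewrite big_split.
  by rewrite big_split /= [X in _ + X]exchange_big /= -mulr2n mulr_natl.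
have -> : \sum_(r <- s) \sum_(t <- s) (t == r)%:R * (y r ^+ 2 * (N%:R / r%:R))
    = N%:R * \sum_(r <- s) y r ^+ 2 / r%:R.
  rewrite mulr_sumr [LHS]big_seq [RHS]big_seq; apply: eq_bigr => r rs.
  rewrite (bigD1_seq r)//= eqxx mul1r big1 ?addr0; last first.
    by move=> t /negbTE->; rewrite mul0r.
  ring.
set V := \sum_(r <- s) y r ^+ 2 / r%:R.
have V0 : 0 <= V by apply: sumr_ge0 => r _; rewrite divr_ge0 ?sqr_ge0.
have : V * \sum_(t <- s) t%:R <= V * N%:R.
  rewrite ler_wpM2l//; apply: (@le_trans _ _ (m * m)%:R); last by rewrite ler_nat.
  by apply: sum_uniq_bounded => // r rs; rewrite sm// prime_gt0 ?ps.
lra.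
Qed.

(** * Concentration of a product over prime divisors *)

Lemma sum_over_divisors_le (R : realType) (N : nat) (s : seq nat) (a : nat -> R) :
  (forall r, r \in s -> 0 <= a r) -> (forall r, r \in s -> prime r) ->
  \sum_(1 <= n < N.+1) \sum_(r <- s | (r %| n)%N) a r
    <= N%:R * \sum_(r <- s) a r / r%:R.
Proof.
move=> a0 ps; under eq_bigr => n _ do rewrite big_mkcond /=.
rewrite exchange_big /= mulr_sumr big_seq [leRHS]big_seq.
apply: ler_sum => r rs.
rewrite (eq_bigr (fun n => a r * (r %| n)%:R)); last first.
  by move=> n _; case: ifP; rewrite ?mulr1 ?mulr0.
rewrite -mulr_sumr sum_dvdn mulrCA ler_wpM2l ?a0//.
by have [] := @divn_natr_bounds R N r (prime_gt0 (ps _ rs)).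
Qed.

Lemma count_large_prime_divisors (N m n : nat) (s : seq nat) :
  uniq s -> (N < m.+1 * m.+1)%N -> (0 < n <= N)%N ->
  (forall r, r \in s -> prime r /\ (m < r)%N) ->
  (count (fun r => r %| n)%N s <= 1)%N.
Proof.
move=> us Nm /andP[n0 nN] sP; rewrite -size_filter.
have : uniq [seq r <- s | (r %| n)%N] by rewrite filter_uniq.
have : forall r, r \in [seq r <- s | (r %| n)%N] ->
    [/\ prime r, (m < r)%N & (r %| n)%N].
  by move=> r; rewrite mem_filter => /andP[rn /sP[]].
case: [seq r <- s | (r %| n)%N] => [//|r [//|t l]] h /=.
rewrite inE negb_or => /andP[/andP[rt _] _].
have [pr mr rn] := h r (mem_head _ _).
have [|pt mt tn] := h t; first by rewrite !inE eqxx orbT.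
have : (r * t %| n)%N by rewrite Gauss_dvd ?rn// prime_coprime// dvdn_prime2.
move=> /(dvdn_leq n0) rtn; have := leq_mul mr mt.
by rewrite leqNgt (leq_ltn_trans (leq_trans rtn nN) Nm).
Qed.

Lemma exists_sqrtn (N : nat) : exists m, (m * m <= N < m.+1 * m.+1)%N.
Proof.
elim: N => [|N [m /andP[mN Nm]]]; first by exists 0%N.
have [h|h] := ltnP N.+1 (m.+1 * m.+1).
  by exists m; rewrite h (leq_trans mN).
by exists m.+1; rewrite h /= (leq_ltn_trans Nm)// ltn_mul.
Qed.

Lemma ler_half_sqr (R : realType) (x e : R) : 0 < e ->
  x <= (e + x ^+ 2 / e) / 2.
Proof.
move=> e0; rewrite -subr_ge0.
have -> : (e + x ^+ 2 / e) / 2 - x = (x - e) ^+ 2 / (2 * e).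
  by field; rewrite lt0r_neq0.
by rewrite divr_ge0 ?sqr_ge0// mulr_ge0// ltW.
Qed.

(** The product [h n] of the [z r] over the [r] dividing [n] is nearly constant
    in the mean. The primes up to [sqrt N] contribute a product close to
    [cis (Y n)], where the additive function [Y] sums the angles [Im (z r)] and
    stays near its mean by the Turan-Kubilius inequality. At most one prime
    above [sqrt N] divides [n], so there the Cauchy-Schwarz inequality costs no
    factor measuring how many such primes there are. *)
Lemma prime_product_concentration (R : realType) (N : nat) (s : seq nat)
    (z : nat -> R[i]) (eta : R) :
  0 < eta <= 1 -> uniq s -> (forall r, r \in s -> prime r) ->
  (forall r, normc (z r) <= 1) ->
  \sum_(r <- s) (1 - complex.Re (z r)) / r%:R <= eta ^+ 2 ->
  exists2 c : R[i], normc c <= 1 &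
    \sum_(1 <= n < N.+1) normc (\prod_(r <- s | (r %| n)%N) z r - c)
      <= 7 * eta * N%:R.
Proof.
move=> /andP[eta0 eta1] us ps z1 hs.
have [m /andP[mN Nm]] := exists_sqrtn N.
pose s1 := [seq r <- s | (r <= m)%N]; pose s2 := [seq r <- s | ~~ (r <= m)%N].
have us1 : uniq s1 by rewrite filter_uniq.
have us2 : uniq s2 by rewrite filter_uniq.
have ps1 r : r \in s1 -> prime r by rewrite mem_filter => /andP[_ /ps].
have ps2 r : r \in s2 -> prime r by rewrite mem_filter => /andP[_ /ps].
pose w r := 1 - complex.Re (z r).
have w0 r : 0 <= w r by rewrite subr_ge0 (le_trans (Re_le_normc _)).
pose y r := complex.Im (z r).
have hs12 : \sum_(r <- s1) w r / r%:R + \sum_(r <- s2) w r / r%:R <= eta ^+ 2.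
  by move: hs; rewrite (bigID (fun r => r <= m)%N) /= !big_filter.
have hs1 : \sum_(r <- s1) w r / r%:R <= eta ^+ 2.
  by rewrite (le_trans _ hs12)// lerDl sumr_ge0// => r _; rewrite divr_ge0.
have hs2 : \sum_(r <- s2) w r / r%:R <= eta ^+ 2.
  by rewrite (le_trans _ hs12)// lerDr sumr_ge0// => r _; rewrite divr_ge0.
(* The vector whose angle is the mean of the additive function. *)
pose c := cis (\sum_(r <- s1) y r / r%:R).
pose T n := \sum_(r <- s1) y r * ((r %| n)%:R - r%:R^-1).
exists c; first by rewrite normc_cis.
apply: (@le_trans _ _ (\sum_(1 <= n < N.+1)
    (\sum_(r <- s1 | (r %| n)%N) 3 * w r + (eta + T n ^+ 2 / eta) / 2
     + (eta / 2 + \sum_(r <- s2 | (r %| n)%N) w r / eta)))).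
  rewrite big_nat_cond [leRHS]big_nat_cond; apply: ler_sum => n.
  rewrite andbT ltnS => nN.
  have -> : \prod_(r <- s | (r %| n)%N) z r =
      \prod_(r <- s1 | (r %| n)%N) z r * \prod_(r <- s2 | (r %| n)%N) z r.
    rewrite (bigID (fun r => r <= m)%N) /= !big_filter_cond.
    by congr (_ * _); apply: eq_bigl => r; rewrite andbC.
  rewrite -[c]mulr1; apply: le_trans (normc_mul_dist _ _ _ _) _.
  - exact: normc_prod_le1.
  - by rewrite normc_cis.
  apply: lerD.
    apply: le_trans (normcB_le _ (\prod_(r <- s1 | (r %| n)%N) cis (y r)) _) _.
    apply: lerD.
      apply: le_trans (normc_prod_dist _ _ _ _) _ => // [r|].
        by rewrite normc_cis.
      by apply: ler_sum => r _; exact: cis_Im_dist.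
    rewrite -cis_sum; apply: le_trans (cis_dist _ _) _.
    have -> : \sum_(r <- s1 | (r %| n)%N) y r - \sum_(r <- s1) y r / r%:R = T n.
      rewrite big_mkcond -sumrB; apply: eq_bigr => r _.
      by case: ifP => _; rewrite mulrBr ?mulr1 ?mulr0.
    by rewrite -[T n ^+ 2]real_normK ?num_real// ler_half_sqr.
  rewrite -[X in _ - X](@big1_eq _ _ *%R _ s2 (fun r => (r %| n)%N)).
  apply: le_trans (normc_prod_dist _ _ _ _) _ => // [r|]; first by rewrite normc1.
  apply: (@le_trans _ _ (\sum_(r <- s2 | (r %| n)%N) (eta / 2 + w r / eta))).
    apply: ler_sum => r _; rewrite normc_distC.
    apply: le_trans (ler_half_sqr _ eta0) _.
    have : normc (1 - z r) ^+ 2 / eta <= 2 * w r / eta.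
      by rewrite ler_wpM2r ?invr_ge0 ?(ltW eta0)// normc_1B_sqr_le.
    lra.
  rewrite big_split /= lerD2r big_const_seq iter_addr addr0.
  have : (count (fun r => r %| n)%N s2 <= 1)%N.
    apply: count_large_prime_divisors us2 Nm nN _ => r rs2; split; first exact: ps2.
    by move: rs2; rewrite mem_filter -ltnNge => /andP[].
  by case: count => [|[|//]] _; rewrite ?mulr0n ?mulr1n// divr_ge0 ?ltW.
rewrite !big_split /= -mulr_suml !big_split /= -mulr_suml !sum_const_range.
have k1 : \sum_(1 <= n < N.+1) \sum_(r <- s1 | (r %| n)%N) 3 * w r
    <= N%:R * (3 * eta ^+ 2).
  apply: le_trans (sum_over_divisors_le _ _ _) _ => // [r _|].
    by rewrite mulr_ge0.
  under eq_bigr => r _ do rewrite -mulrA.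
  by rewrite -mulr_sumr !ler_wpM2l.
have k2 : \sum_(1 <= n < N.+1) \sum_(r <- s2 | (r %| n)%N) w r / eta
    <= N%:R * eta.
  apply: le_trans (sum_over_divisors_le _ _ _) _ => // [r _|].
    by rewrite divr_ge0 ?(ltW eta0).
  under eq_bigr => r _ do rewrite mulrAC.
  by rewrite -mulr_suml ler_wpM2l// ler_pdivrMr// -expr2.
have k3 : (\sum_(1 <= n < N.+1) T n ^+ 2) / eta <= N%:R * (4 * eta).
  rewrite ler_pdivrMr//.
  apply: le_trans (turan_kubilius _ us1 mN ps1 _) _ => [r|].
    by rewrite mem_filter => /andP[].
  have : \sum_(r <- s1) y r ^+ 2 / r%:R <= 2 * eta ^+ 2.
    apply: (@le_trans _ _ (\sum_(r <- s1) 2 * (w r / r%:R))).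
      apply: ler_sum => r _; rewrite mulrA ler_wpM2r ?invr_ge0//.
      exact: Im_sqr_le.
    by rewrite -mulr_sumr ler_wpM2l.
  move=> /(ler_wpM2l (_ : 0 <= 2 * N%:R)) => /(_ (mulr_ge0 _ _)) h.
  by apply: (le_trans (h _ _)) => //; lra.
have k4 : N%:R * eta ^+ 2 <= N%:R * eta.
  by rewrite ler_wpM2l// expr2 ler_piMl// ltW.
lra.
Qed.

(** * Dirichlet characters and pretentiousness *)

Section Character.

Variables (R : realType) (q : nat) (chi : int -> R[i]).
Hypothesis chiP : dirichlet_character q chi.

Lemma character1 : chi 1 = 1.
Proof.
have [_ chiM _ chi_neq0] := chiP.
have c1 : chi 1 != 0 by rewrite chi_neq0 coprimezE/= coprime1n.
by apply: (mulfI c1); rewrite -chiM !mulr1.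
Qed.

Lemma character_addM (n k : int) : chi (n + k * q%:Z) = chi n.
Proof.
have [_ _ chiD _] := chiP.
have nat_case (m : int) (j : nat) : chi (m + j%:Z * q%:Z) = chi m.
  elim: j => [|j IH]; first by rewrite mul0r addr0.
  by rewrite -addn1 PoszD mulrDl mul1r addrA chiD.
case: k => j; first exact: nat_case.
by rewrite NegzE mulNr -[n in RHS](subrK (j.+1%:Z * q%:Z)) nat_case.
Qed.

Lemma character_eq_mod (a b : nat) : a = b %[mod q] -> chi a%:Z = chi b%:Z.
Proof.
move=> ab; rewrite (divn_eq a q) (divn_eq b q) ab !PoszD !PoszM.
by rewrite ![(_ * q%:Z) + _]addrC !character_addM.
Qed.

Lemma characterX (a k : nat) : chi (a ^ k)%N%:Z = chi a%:Z ^+ k.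
Proof.
have [_ chiM _ _] := chiP.
elim: k => [|k IH]; first by rewrite expr0 character1.
by rewrite expnS PoszM chiM IH exprS.
Qed.

(** The values at units are roots of unity, by Euler's theorem. *)
Lemma normc_character_coprime (a : nat) : coprime a q -> normc (chi a%:Z) = 1.
Proof.
move=> aq; have [q0 _ _ _] := chiP.
have := characterX a (totient q).
rewrite (character_eq_mod (Euler_exp_totient aq)) character1.
move=> /(congr1 (@normc R)); rewrite normc1.
have -> : normc (chi a%:Z ^+ totient q) = normc (chi a%:Z) ^+ totient q.
  by elim: (totient q) => [|k IH]; rewrite ?expr0 ?normc1// !exprS normcM IH.
move=> /esym/eqP; rewrite pexpr_eq1 ?normc_ge0 ?totient_gt0//.
by move=> /eqP.
Qed.

Lemma normc_character_le1 (n : int) : normc (chi n) <= 1.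
Proof.
have [q0 _ _ chi_neq0] := chiP.
have -> : chi n = chi (`|(n %% q%:Z)%Z|%N)%:Z.
  rewrite gez0_abs ?modz_ge0 ?lt0n_neq0// {1}(divz_eq n q%:Z).
  by rewrite addrC character_addM.
set a := `|_|%N; have [aq|aq] := boolP (coprime a q).
  by rewrite normc_character_coprime.
have : chi a%:Z == 0.
  by rewrite -[_ == _]negbK chi_neq0 coprimezE.
by move=> /eqP->; rewrite normc0.
Qed.

End Character.

Lemma bounded_normc (R : realType) (f : int -> R[i]) (n : int) :
  bounded_by_one f -> normc (f n) <= 1.
Proof. by move=> /(_ n); rewrite normc_norm -(lecR (normc (f n)) 1). Qed.

(** Finiteness of the distance says that the series of nonnegative terms
    [(1 - Re (f r conj (g r))) / r] over the primes converges. *)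
Lemma pretends_to_be_tail (R : realType) (f g : int -> R[i]) (e : R) :
  (forall n, normc (f n) <= 1) -> (forall n, normc (g n) <= 1) ->
  pretends_to_be f g -> 0 < e ->
  exists K0 : nat, forall K N : nat, (K0 <= K)%N ->
    \sum_(K.+1 <= r < N.+1 | prime r)
      (1 - complex.Re (f r%:Z * (g r%:Z)^*)) / r%:R <= e.
Proof.
move=> f1 g1 fg e0.
pose a r : R := (1 - complex.Re (f r%:Z * (g r%:Z)^*)) / r%:R.
have a0 r : 0 <= a r.
  rewrite divr_ge0// subr_ge0 (le_trans (Re_le_normc _))// normcM normcJ.
  by rewrite mulr_ile1 ?normc_ge0.
have D_fin : (pretentious_dist2 f g < +oo)%E.
  move: fg; rewrite /pretends_to_be /pretentious_dist.
  by case: (pretentious_dist2 f g) => //= r _; rewrite ltry.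
pose u n := \sum_(0 <= r < n | prime r) a r.
have aE r : (r%:R^-1 * (1 - complex.Re (f r%:Z * (g r%:Z)^*)))%:E = (a r)%:E.
  by rewrite mulrC.
have u_bounded n : ((u n)%:E <= pretentious_dist2 f g)%E.
  rewrite /u -sumEFin /pretentious_dist2.
  under [leRHS]eq_eseriesr do rewrite aE.
  by apply: nneseries_lim_ge => r _ _; rewrite lee_fin.
have sup_u : has_sup (range u).
  split; first by exists (u 0%N), 0%N.
  exists (fine (pretentious_dist2 f g)) => _ [n _ <-].
  rewrite -lee_fin fineK//; apply/fin_numPlt; rewrite D_fin andbT.
  by rewrite (lt_le_trans _ (u_bounded 0%N))// ltNyr.
have [_ [K0 _ <-] hK0] := sup_adherent e0 sup_u.
exists K0 => K N K0K; rewrite -/a.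
have [NK|KN] := leqP N.+1 K.+1; first by rewrite big_geq// ltW.
have : u N.+1 <= sup (range u) by apply: (sup_upper_bound sup_u); exists N.+1.
have split_u : u N.+1 = u K0 + \sum_(K0 <= r < N.+1 | prime r) a r.
  rewrite /u -big_cat_nat//.
  exact: leq_trans K0K (leq_trans (leqnSn _) (ltnW KN)).
have : \sum_(K.+1 <= r < N.+1 | prime r) a r
    <= \sum_(K0 <= r < N.+1 | prime r) a r.
  rewrite (@big_cat_nat _ _ _ K.+1 K0)//= ?(leqW K0K) ?(ltnW KN)//.
  by rewrite lerDr sumr_ge0.
rewrite /a in split_u *; lra.
Qed.

(** * The periodic model *)

Definition primes_between (K N : nat) : seq nat :=
  [seq r <- index_iota K.+1 N.+1 | prime r].

Lemma mem_primes_between (K N r : nat) :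
  (r \in primes_between K N) = [&& prime r, (K < r)%N & (r <= N)%N].
Proof. by rewrite mem_filter mem_index_iota ltnS. Qed.

Lemma primes_between_uniq (K N : nat) : uniq (primes_between K N).
Proof. by rewrite filter_uniq ?iota_uniq. Qed.

(** Primes in [S] are left out so that the period can avoid them. *)
Definition smooth_modulus (S : pred nat) (K L : nat) : nat :=
  \prod_(r <- primes_between 0 K | ~~ S r) r ^ L.

Lemma smooth_modulus_gt0 (S : pred nat) (K L : nat) :
  (0 < smooth_modulus S K L)%N.
Proof.
rewrite /smooth_modulus big_seq_cond; apply: prodn_cond_gt0 => r.
by rewrite mem_primes_between => /andP[/and3P[/prime_gt0 r0 _ _] _]; rewrite expn_gt0 r0.
Qed.

Lemma prime_dvd_smooth_modulus (S : pred nat) (K L t : nat) : prime t ->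
  (t %| smooth_modulus S K L)%N -> (t <= K)%N && ~~ S t.
Proof.
move=> pt; rewrite /smooth_modulus Euclid_dvd_prod// big_has_cond.
move=> /hasP[r]; rewrite mem_primes_between => /and3P[pr _ rK] /andP[Sr].
rewrite Euclid_dvdX// => /andP[]; rewrite dvdn_prime2// => /eqP-> _.
by rewrite rK.
Qed.

Lemma pfactor_dvd_smooth_modulus (S : pred nat) (K L t : nat) :
  prime t -> (t <= K)%N -> ~~ S t -> (t ^ L %| smooth_modulus S K L)%N.
Proof.
move=> pt tK St; rewrite /smooth_modulus big_mkcond (bigD1_seq t) ?primes_between_uniq//=.
  by rewrite St dvdn_mulr.
by rewrite mem_primes_between pt prime_gt0.
Qed.

(** The gcd with [Q] stands for the part of [n] at the small primes: unlike the
    true smooth part it only depends on [n] modulo [Q]. *)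
Definition model (R : realType) (f chi : int -> R[i]) (Q : nat) (n : int) :
    R[i] :=
  f (gcdn `|n| Q)%:Z * chi (n %/ (gcdn `|n| Q)%:Z)%Z.

Definition twist_ratio (R : realType) (f chi : int -> R[i]) (r : nat) : R[i] :=
  f r%:Z * (chi r%:Z)^*.

Definition exceptional (S : pred nat) (K L N n : nat) : bool :=
  has (fun r => r ^ L %| n)%N (primes_between 0 K) ||
  has (fun r => r ^ 2 %| n)%N (primes_between K N).

Section Model.

Variables (R : realType) (q : nat) (f chi : int -> R[i]) (S : pred nat).
Hypothesis chiP : dirichlet_character q chi.
Hypothesis f_mult : multiplicative_fun f.
Hypothesis f_le1 : forall n, normc (f n) <= 1.
Hypothesis fS : forall r s : nat, prime r -> S r -> (0 < s)%N ->
  f (r ^ s)%N%:Z = chi (r ^ s)%N%:Z.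

Lemma normc_model_le1 (Q : nat) (n : int) : normc (model f chi Q n) <= 1.
Proof.
by rewrite normcM mulr_ile1 ?normc_ge0// (normc_character_le1 chiP).
Qed.

Lemma model_periodic (Q : nat) (n : int) : (0 < Q)%N ->
  model f chi Q (n + (q * Q)%N%:Z) = model f chi Q n.
Proof.
move=> Q0; rewrite /model.
have gE : gcdn `|(n + (q * Q)%N%:Z)%R| Q = gcdn `|n| Q.
  have := gcdzMDl q%:Z Q%:Z n; rewrite addrC -PoszM => h.
  by have := congr1 absz h; rewrite /gcdz !absz_nat gcdnC => ->; rewrite gcdnC.
rewrite gE; congr (_ * _); set d := gcdn _ _.
have d0 : d%:Z != 0 by rewrite eqz_nat -lt0n gcdn_gt0 Q0 orbT.
have /dvdnP[k ->] : (d %| Q)%N by rewrite dvdn_gcdr.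
by rewrite mulnA PoszM addrC divzMDl// addrC PoszM mulrC (character_addM chiP).
Qed.

(** Numbers all of whose prime factors are either large and simple, or small
    and in [S]. The factor [f 1] is idempotent and can be 0, in which case [f]
    vanishes on all positive integers. *)
Lemma multiplicative_rough (K N m : nat) :
  (q <= K)%N -> (0 < m <= N)%N ->
  (forall r, prime r -> (r %| m)%N ->
     (r <= K)%N && S r || (K < r)%N && ~~ (r ^ 2 %| m)%N) ->
  f m%:Z = f 1 *
    (chi m%:Z * \prod_(r <- primes_between K N | (r %| m)%N) twist_ratio f chi r).
Proof.
move=> qK; have [q0 chiM _ _] := chiP.
elim/ltn_ind: m => m IH /andP[m0 mN] mP.
have [m1|m1] := leqP m 1.
  have -> : m = 1%N by apply/eqP; rewrite eqn_leq m1.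
  rewrite (character1 chiP) mul1r big_seq_cond big1 ?mulr1// => r.
  rewrite mem_primes_between => /andP[/and3P[pr _ _]].
  by rewrite Euclid_dvd1.
pose r := pdiv m; have pr : prime r := pdiv_prime m1.
have [m' crm' mE] := pfactor_coprime pr m0.
set s := logn r m in mE.
have s0 : (0 < s)%N by rewrite logn_gt0 mem_primes pr m0 pdiv_dvd.
have m'0 : (0 < m')%N by move: m0; rewrite mE muln_gt0 => /andP[].
have m'm : (m' < m)%N by rewrite mE ltn_Pmulr// -[1%N](exp1n s) ltn_exp2r ?prime_gt1.
have m'dvd : (m' %| m)%N by rewrite mE dvdn_mulr.
have IHm' : f m'%:Z = f 1 * (chi m'%:Z *
    \prod_(t <- primes_between K N | (t %| m')%N) twist_ratio f chi t).
  apply: IH => //; first by rewrite m'0 (leq_trans (ltnW m'm)).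
  move=> t pt tm'; have := mP t pt (dvdn_trans tm' m'dvd).
  case/orP=> [->//|/andP[-> h]]; rewrite orbC /=.
  by rewrite (contra _ h)// => h'; apply: dvdn_trans h' m'dvd.
have rs_m' : coprime (r ^ s) m' by rewrite coprimeXl.
have dvdE t : prime t -> (t %| m)%N = (t == r) || (t %| m')%N.
  by move=> pt; rewrite mE Euclid_dvdM// Euclid_dvdX// s0 andbT (dvdn_prime2 pt pr) orbC.
have rm' : ~~ (r %| m')%N by rewrite -prime_coprime.
have fmE : f m%:Z = f (r ^ s)%N%:Z * f m'%:Z.
  by rewrite mE mulnC f_mult// expn_gt0 prime_gt0.
have chimE : chi m%:Z = chi (r ^ s)%N%:Z * chi m'%:Z by rewrite mE mulnC PoszM chiM.
rewrite fmE chimE IHm'; case/orP: (mP r pr (pdiv_dvd m)) => /andP[rK rS].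
  rewrite fS//.
  have -> : \prod_(t <- primes_between K N | (t %| m)%N) twist_ratio f chi t =
            \prod_(t <- primes_between K N | (t %| m')%N) twist_ratio f chi t.
    rewrite [LHS]big_seq_cond [RHS]big_seq_cond; apply: eq_bigl => t.
    apply: andb_id2l; rewrite mem_primes_between => /and3P[pt Kt _].
    by rewrite dvdE//; case: eqP => // tr; rewrite tr ltnNge rK in Kt.
  by rewrite -!mulrA mulrCA.
have s1 : s = 1%N.
  by apply/eqP; rewrite eqn_leq s0 andbT leqNgt -pfactor_dvdn.
have r_in : r \in primes_between K N.
  by rewrite mem_primes_between pr rK (leq_trans (dvdn_leq m0 (pdiv_dvd m))).
have -> : \prod_(t <- primes_between K N | (t %| m)%N) twist_ratio f chi t =
    twist_ratio f chi r *
    \prod_(t <- primes_between K N | (t %| m')%N) twist_ratio f chi t.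
  rewrite [LHS]big_mkcond (bigD1_seq r) ?primes_between_uniq//= pdiv_dvd.
  congr (_ * _); rewrite -big_mkcondr [LHS]big_seq_cond [RHS]big_seq_cond.
  apply: eq_bigl => t; apply: andb_id2l.
  rewrite mem_primes_between => /and3P[pt Kt _]; rewrite dvdE//.
  by case: eqP => //= ->; rewrite (negbTE rm').
have -> : f (r ^ s)%N%:Z = chi (r ^ s)%N%:Z * twist_ratio f chi r.
  rewrite s1 expn1 /twist_ratio mulrCA -sqr_normc normc_norm.
  rewrite (normc_character_coprime chiP) ?expr1n ?mulr1//.
  rewrite prime_coprime// gtnNdvd//; exact: leq_ltn_trans qK rK.
ring.
Qed.

(** Away from the exceptional integers, [d = gcd (n, Q)] carries the whole part
    of [n] at the primes at most [K] outside [S]; hence [d] is prime to the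
    cofactor [n / d], on which [f] differs from [chi] only through the
    product over large primes. *)
Lemma multiplicative_model (K L N n : nat) :
  (q <= K)%N -> (0 < n <= N)%N -> ~~ exceptional S K L N n ->
  f n%:Z = model f chi (smooth_modulus S K L) n%:Z *
    \prod_(r <- primes_between K N | (r %| n)%N) twist_ratio f chi r.
Proof.
move=> qK /andP[n0 nN]; rewrite negb_or => /andP[/hasPn smallP /hasPn largeP].
set Q := smooth_modulus S K L; have Q0 : (0 < Q)%N := smooth_modulus_gt0 S K L.
rewrite /model absz_nat divz_nat; set d := gcdn n Q; set m := (n %/ d)%N.
have dn : (d %| n)%N by rewrite dvdn_gcdl.
have nE : n = (d * m)%N by rewrite mulnC divnK.
have d0 : (0 < d)%N by rewrite gcdn_gt0 n0.
have m0 : (0 < m)%N by move: n0; rewrite nE muln_gt0 => /andP[].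
have mn : (m %| n)%N by rewrite nE dvdn_mull.
(* The bound [logn t n < L] is what makes [d] exhaust the power of [t] in [n]. *)
have small_m t : prime t -> (t <= K)%N -> ~~ S t -> ~~ (t %| m)%N.
  move=> pt tK St.
  have tL : (logn t n < L)%N.
    rewrite ltnNge -pfactor_dvdn// smallP// mem_primes_between pt prime_gt0//.
  have ltd : logn t d = logn t n.
    rewrite /d logn_gcd//; apply/minn_idPl; rewrite (leq_trans (ltnW tL))//.
    by rewrite -pfactor_dvdn//; exact: pfactor_dvd_smooth_modulus.
  have := ltd; rewrite nE lognM// => /eqP; rewrite -[X in X == _]addn0 eqn_add2l.
  by rewrite eq_sym -leqn0 leqNgt logn_gt0 mem_primes pt m0.
have cdm : coprime d m.
  apply: contraT; rewrite /coprime => gcd1.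
  have g1 : (1 < gcdn d m)%N.
    by rewrite ltn_neqAle eq_sym gcd1 gcdn_gt0 d0.
  have pt := pdiv_prime g1.
  have := pdiv_dvd (gcdn d m); rewrite dvdn_gcd => /andP[td tm].
  have /andP[tK St] := prime_dvd_smooth_modulus pt (dvdn_trans td (dvdn_gcdr n Q)).
  by have := small_m _ pt tK St; rewrite tm.
have -> : \prod_(r <- primes_between K N | (r %| n)%N) twist_ratio f chi r =
          \prod_(r <- primes_between K N | (r %| m)%N) twist_ratio f chi r.
  rewrite [LHS]big_seq_cond [RHS]big_seq_cond; apply: eq_bigl => t.
  apply: andb_id2l; rewrite mem_primes_between => /and3P[pt Kt _].
  rewrite nE Euclid_dvdM//; case: (boolP (t %| d)%N) => //= td.
  have /andP[] := prime_dvd_smooth_modulus pt (dvdn_trans td (dvdn_gcdr n Q)).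
  by rewrite leqNgt Kt.
rewrite nE f_mult//.
rewrite (@multiplicative_rough K N m)//.
- rewrite mulrA -f_mult ?coprimen1// muln1; ring.
- by rewrite m0 (leq_trans (dvdn_leq n0 mn)).
move=> t pt tm; have [Kt|tK] := ltnP K t.
  rewrite /= (contra (fun h => dvdn_trans h mn)) ?orbT// largeP//.
  by rewrite mem_primes_between pt Kt (leq_trans (dvdn_leq m0 tm))// (leq_trans (dvdn_leq n0 mn)).
by rewrite orbF; apply: contraLR tm => St; exact: small_m.
Qed.

End Model.

(** ** Density of the exceptional integers *)

Lemma sum_inv_sqr_tail (R : realType) (K N : nat) : (0 < K)%N ->
  \sum_(K.+1 <= r < N.+1) (r%:R ^+ 2)^-1 <= K%:R^-1 :> R.
Proof.
move=> K0; have [NK|KN] := leqP N K; first by rewrite big_geq// invr_ge0.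
suff: \sum_(K.+1 <= r < N.+1) (r%:R ^+ 2)^-1 <= K%:R^-1 - N%:R^-1 :> R.
  by move=> h; rewrite (le_trans h)// gerBl invr_ge0.
(* [1 / r ^ 2 <= 1 / (r - 1) - 1 / r] telescopes. *)
apply: (@le_trans _ _ (\sum_(K.+1 <= r < N.+1) (r.-1%:R^-1 - r%:R^-1))).
  rewrite big_nat_cond [leRHS]big_nat_cond; apply: ler_sum => -[//|r].
  rewrite ltnS andbT => /andP[Kr _] /=.
  have r0 : 0 < r%:R :> R by rewrite ltr0n (leq_trans K0).
  have r1 : 0 < r.+1%:R :> R by rewrite ltr0n.
  have -> : r%:R^-1 - r.+1%:R^-1 = (r%:R * r.+1%:R)^-1 :> R.
    by rewrite -natr1 in r1 *; field; rewrite !lt0r_neq0.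
  rewrite lef_pV2 ?posrE ?exprn_gt0 ?mulr_gt0// expr2 ler_wpM2r ?ltW//.
  by rewrite ltr_nat.
rewrite big_add1 /=.
rewrite (@telescope_sumr_eq R K N (fun r => - r%:R^-1)) ?(ltnW KN)//.
  by rewrite opprK addrC.
by move=> r _; rewrite opprK addrC.
Qed.

Lemma exceptional_count (R : realType) (S : pred nat) (K L N : nat) :
  (0 < K)%N ->
  \sum_(1 <= n < N.+1) (exceptional S K L N n)%:R
    <= N%:R * (K%:R / 2 ^+ L + K%:R^-1) :> R.
Proof.
move=> K0.
have has_le (s : seq nat) k n :
    (has (fun r => r ^ k %| n)%N s)%:R <= \sum_(r <- s) (r ^ k %| n)%:R :> R.
  elim: s => [|r s IH]; first by rewrite big_nil.
  rewrite big_cons /=; case: (r ^ k %| n)%N => /=; last by rewrite add0r.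
  by rewrite lerDl sumr_ge0.
have sum_le (s : seq nat) k : (forall r, r \in s -> (0 < r)%N) ->
    \sum_(1 <= n < N.+1) \sum_(r <- s) (r ^ k %| n)%:R
      <= N%:R * \sum_(r <- s) (r%:R ^+ k)^-1 :> R.
  move=> s0; rewrite exchange_big mulr_sumr /= big_seq [leRHS]big_seq.
  apply: ler_sum => r /s0 r0; rewrite sum_dvdn -natrX.
  by have [] := @divn_natr_bounds R N (r ^ k); rewrite ?expn_gt0 ?r0.
apply: (@le_trans _ _ (\sum_(1 <= n < N.+1)
    (\sum_(r <- primes_between 0 K) (r ^ L %| n)%:R +
     \sum_(r <- primes_between K N) (r ^ 2 %| n)%:R))).
  apply: ler_sum => n _; apply: le_trans (lerD (has_le _ _ _) (has_le _ _ _)).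
  by rewrite -natrD ler_nat /exceptional; case: has; case: has.
have gt0 M M' r : r \in primes_between M M' -> (0 < r)%N.
  by rewrite mem_primes_between => /and3P[/prime_gt0].
rewrite big_split mulrDr; apply: lerD; apply: le_trans (sum_le _ _ (gt0 _ _)) _;
  rewrite ler_wpM2l// big_filter.
  apply: (@le_trans _ _ (\sum_(1 <= r < K.+1 | prime r) (2 ^+ L)^-1)).
    apply: ler_sum => r pr; rewrite lef_pV2 ?posrE ?exprn_gt0 ?ltr0n ?prime_gt0//.
    by rewrite lerXn2r ?nnegrE// ler_nat prime_gt1.
  rewrite big_mkcond -sum_const_range; apply: ler_sum => r _.
  by case: ifP => // _; rewrite invr_ge0 exprn_ge0.
apply: le_trans (sum_inv_sqr_tail R N K0); rewrite big_mkcond.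
by apply: ler_sum => r _; case: ifP => // _; rewrite invr_ge0 sqr_ge0.
Qed.

(** * Approximation in mean by a multiple of a periodic function *)

Lemma natr_archi (R : realType) (x : R) : exists n : nat, x <= n%:R.
Proof.
exists (Num.bound x); have [x0|x0] := leP 0 x; first exact/ltW/archi_boundP.
by rewrite (le_trans (ltW x0)).
Qed.

(** The constant [c] depends on [N]: the imaginary parts of the series defining
    the distance need not converge, so the phase of [f] may drift with the
    scale. The period does not depend on [N], and its prime factors in [S] all
    come from the conductor [q]. *)
Lemma pretentious_approximation (R : realType) (q : nat) (f chi : int -> R[i])
    (S : pred nat) (e : R) :
  dirichlet_character q chi -> multiplicative_fun f ->
  (forall n, normc (f n) <= 1) ->
  (forall r s : nat, prime r -> S r -> (0 < s)%N ->
    f (r ^ s)%N%:Z = chi (r ^ s)%N%:Z) ->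
  pretends_to_be f chi -> 0 < e ->
  exists2 Q : nat,
    (0 < Q)%N /\ (forall t, prime t -> S t -> ~~ (t %| Q)%N) &
    forall N : nat, exists2 c : R[i], normc c <= 1 &
      \sum_(1 <= n < N.+1) normc (f n%:Z - c * model f chi Q n%:Z) <= e * N%:R.
Proof.
move=> chiP f_mult f1 fS fchi e0.
have chi1 := normc_character_le1 chiP.
(* The exceptional integers cost at most [2 * (e / 8 + e / 8)] on average, and
   the oscillation of the product over large primes [7 * eta <= e / 2]. *)
pose eta := Num.min 1 (e / 14).
have eta0 : 0 < eta by rewrite lt_min ltr01 divr_gt0.
have eta1 : eta <= 1 by rewrite ge_min lexx.
have eta_e : 14 * eta <= e.
  by rewrite mulrC -ler_pdivlMr// ge_min lexx orbT.
have [K0 tail] := pretends_to_be_tail f1 chi1 fchi (exprn_gt0 2 eta0).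
have [K1 K1e] := natr_archi (8 / e).
pose K := (K0 + q + K1 + 1)%N.
have K_gt0 : (0 < K)%N by rewrite /K addn1.
have K_ge_q : (q <= K)%N by rewrite /K -!addnA addnCA leq_addr.
have K_ge_K0 : (K0 <= K)%N by rewrite /K -!addnA leq_addr.
have K_ge_K1 : (K1 <= K)%N by rewrite /K addnAC leq_addl.
have invK : K%:R^-1 <= e / 8.
  rewrite -[leRHS]invrK invf_div lef_pV2 ?posrE ?divr_gt0 ?ltr0n//.
  by rewrite (le_trans K1e)// ler_nat.
have [L Le] := natr_archi (8 * K%:R / e).
have powL : K%:R / 2 ^+ L <= e / 8.
  rewrite ler_pdivrMr ?exprn_gt0//; move: Le; rewrite ler_pdivrMr//.
  have : L%:R * e <= 2 ^+ L * e.
    by rewrite ler_wpM2r ?(ltW e0)// -natrX ler_nat ltnW// ltn_expl.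
  lra.
exists (smooth_modulus S K L).
  split; first exact: smooth_modulus_gt0.
  move=> t pt St; apply/negP => /(prime_dvd_smooth_modulus pt).
  by rewrite St andbF.
move=> N; pose h n := \prod_(r <- primes_between K N | (r %| n)%N)
  twist_ratio f chi r.
have ratio1 r : normc (twist_ratio f chi r) <= 1.
  by rewrite normcM normcJ mulr_ile1 ?normc_ge0.
have [||r|r||c c1 hc] := @prime_product_concentration R N
    (primes_between K N) (twist_ratio f chi) eta.
- by rewrite eta0.
- exact: primes_between_uniq.
- by rewrite mem_primes_between => /andP[].
- exact: ratio1.
- by rewrite big_filter; exact: tail.
exists c => //.
apply: (@le_trans _ _ (\sum_(1 <= n < N.+1)
    (2 * (exceptional S K L N n)%:R + normc (h n - c)))).
  rewrite big_nat_cond [leRHS]big_nat_cond; apply: ler_sum => n.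
  rewrite andbT ltnS => nN.
  have P1 := normc_model_le1 chiP f1 (smooth_modulus S K L) n%:Z.
  have [|good] := boolP (exceptional S K L N n).
    rewrite mulr1 => _; rewrite (@le_trans _ _ 2) ?lerDl ?normc_ge0//.
    rewrite (le_trans (le_normcD _ _))// normcN normcM -[2]natr1 lerD//.
    by rewrite mulr_ile1 ?normc_ge0.
  rewrite mulr0 add0r (multiplicative_model chiP f_mult fS K_ge_q nN good).
  by rewrite mulrC -mulrBl normcM ler_piMr ?normc_ge0.
rewrite big_split /= -mulr_sumr.
have := exceptional_count R S L N K_gt0.
have : N%:R * (K%:R / 2 ^+ L + K%:R^-1) <= N%:R * (e / 8 + e / 8).
  by rewrite ler_wpM2l// lerD.
have : 14 * eta * N%:R <= e * N%:R by rewrite ler_wpM2r.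
lra.
Qed.

(** * Exponential sums with periodic coefficients *)

Lemma expi2pi_cis (R : realType) (t : R) : expi2pi t = cis (2 * pi * t).
Proof. by []. Qed.

Lemma expi2piD (R : realType) (s t : R) :
  expi2pi (s + t) = expi2pi s * expi2pi t.
Proof. by rewrite !expi2pi_cis -cisD -mulrDr. Qed.

Lemma expi2pi_eq1 (R : realType) (t : R) :
  expi2pi t = 1 -> exists k : int, t = k%:~R.
Proof.
have cis_int (k : int) : cis (2 * pi * k%:~R) = 1 :> R[i].
  have cis_nat n : cis (2 * pi * n%:R) = 1 :> R[i].
    elim: n => [|n IH]; first by rewrite mulr0 cis0.
    rewrite -[n.+1%:R]natr1 mulrDr mulr1 cisD IH mul1r mulr_natl.
    by apply/eqP; rewrite eq_complex /= cos2pi sin2pi !eqxx.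
  case: k => n; first exact: cis_nat.
  rewrite NegzE mulrNz mulrN; pose x : R := 2 * pi * n.+1%:R.
  have := cisD x (- x).
  by rewrite subrr cis0 /x cis_nat mul1r => <-.
move=> t1; exists (Num.floor t); apply/eqP; rewrite -subr_eq0.
set s := t - _; have s0 : 0 <= s by rewrite subr_ge0 floor_le.
have s1 : s < 1 by have := floorD1_gt t; rewrite intrD1 -ltrBlDl.
have : cis (2 * pi * s) * cis (2 * pi * (Num.floor t)%:~R) = 1.
  by rewrite -cisD -mulrDr subrK -t1.
rewrite cis_int mulr1 => /(congr1 (@complex.Re R)) /=; rewrite -mulrA mulr_natl cos_mulr2n.
move=> cos1; have sin0 : sin (pi * s) = 0.
  apply/eqP; rewrite -sqrf_eq0; apply/eqP.
  by have := cos2Dsin2 (pi * s); move: cos1; rewrite -mulr_natr; lra.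
rewrite eq_le s0 andbT leNgt; apply/negP => s_gt0.
have : 0 < sin (pi * s).
  by rewrite sin_gt0_pi// mulr_gt0 ?pi_gt0//= gtr_pMr ?pi_gt0.
by rewrite sin0 ltxx.
Qed.

Lemma normc_telescope_le (R : realType) (F : nat -> R[i]) (M N : nat) :
  (forall n, normc (F n) <= 1) ->
  normc (\sum_(1 <= n < N.+1) F (n + M)%N - \sum_(1 <= n < N.+1) F n)
    <= 2 * M%:R.
Proof.
move=> F1; elim: M => [|M IH].
  by under eq_bigr => n _ do rewrite addn0; rewrite subrr normc0 mulr0.
apply: le_trans (normcB_le _ (\sum_(1 <= n < N.+1) F (n + M)%N) _) _.
rewrite -[M.+1%:R]natr1 mulrDr mulr1 addrC lerD// -sumrB.
under eq_bigr => n _ do rewrite addnS -addSn.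
rewrite (telescope_sumr (fun n => F (n + M)%N))//.
by rewrite (le_trans (le_normcD _ _))// normcN -[2]natr1 lerD.
Qed.

(** Shifting the sum by the period multiplies it by [e(M alpha)] and changes
    only [2 M] terms. *)
Lemma periodic_exponential_sum_le (R : realType) (alpha : R) (M N : nat)
    (G : int -> R[i]) :
  (forall n, normc (G n) <= 1) -> (forall n, G (n + M%:Z) = G n) ->
  normc (expi2pi (M%:R * alpha) - 1) *
    normc (\sum_(1 <= n < N.+1) expi2pi (n%:R * alpha) * G n%:Z) <= 2 * M%:R.
Proof.
move=> G1 GM; pose F n := expi2pi (n%:R * alpha) * G n%:Z.
have F1 n : normc (F n) <= 1 by rewrite normcM expi2pi_cis normc_cis mul1r.
rewrite -normcM mulrBl mul1r mulr_sumr.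
apply: le_trans (normc_telescope_le M N F1); rewrite le_eqVlt; apply/orP; left.
apply/eqP; congr (normc (_ - _)); apply: eq_bigr => n _.
rewrite /F PoszD GM.
have -> : (n + M)%:R * alpha = M%:R * alpha + n%:R * alpha.
  by rewrite (natrD _ n M) mulrDl addrC.
by rewrite expi2piD mulrA.
Qed.

Lemma sum_shift_le (R : realType) (B : R) (G : int -> R) (N : nat) (t : int) :
  (forall n, 0 <= G n <= B) ->
  \sum_(1 <= n < N.+1) G (n%:Z + t) <= \sum_(1 <= n < N.+1) G n%:Z + `|t|%N%:R * B.
Proof.
have up (H : int -> R) : (forall n, 0 <= H n <= B) ->
    \sum_(1 <= n < N.+1) H (n%:Z + 1) <= \sum_(1 <= n < N.+1) H n%:Z + B.
  move=> HB; rewrite -lerBlDl -sumrB.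
  rewrite (@telescope_sumr_eq R 1 N.+1 (fun n => H n%:Z))//; last first.
    by move=> n _; rewrite -addn1 PoszD.
  have := HB N.+1; have := HB 1; lra.
have down (H : int -> R) : (forall n, 0 <= H n <= B) ->
    \sum_(1 <= n < N.+1) H (n%:Z - 1) <= \sum_(1 <= n < N.+1) H n%:Z + B.
  move=> HB; rewrite -lerBlDl -sumrB.
  rewrite (@telescope_sumr_eq R 1 N.+1 (fun n => - H (n%:Z - 1)))//; last first.
    by move=> n _; rewrite -addn1 PoszD addrK opprK addrC.
  have := HB (N.+1%:Z - 1); have := HB (1%:Z - 1); lra.
have iter (d : int) : (forall H : int -> R, (forall n, 0 <= H n <= B) ->
    \sum_(1 <= n < N.+1) H (n%:Z + d) <= \sum_(1 <= n < N.+1) H n%:Z + B) ->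
  forall k (H : int -> R), (forall n, 0 <= H n <= B) ->
    \sum_(1 <= n < N.+1) H (n%:Z + d *+ k)
      <= \sum_(1 <= n < N.+1) H n%:Z + k%:R * B.
  move=> step; elim=> [|k IH] H HB.
    by rewrite mul0r addr0; under eq_bigr => n _ do rewrite mulr0n addr0.
  under eq_bigr => n _ do rewrite mulrSr addrA.
  apply: le_trans (IH (fun n => H (n + d)) (fun n => HB _)) _.
  by have := step H HB; rewrite -natr1; lra.
move=> GB; case: t => k.
  have := iter 1 up k G GB; rewrite absz_nat.
  by under eq_bigr => n _ do rewrite -[1 *+ k]/(k%:R) natz.
have := iter (-1) down k.+1 G GB; rewrite NegzE abszN absz_nat.
by under eq_bigr => n _ do rewrite mulNrn -[1 *+ k.+1]/(k.+1%:R) natz.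
Qed.

(** * Vanishing of the twisted correlations *)

(** If [alpha] times the period were an integer, then [alpha] would be rational
    and, when [alpha = k / p], the prime [p] would divide the period; but the
    primes at which [f] agrees with [chi] can be left out of it. *)
Lemma nonresonant_period (R : realType) (f chi : int -> R[i]) (q : nat)
    (alpha : R) :
  (0 < q)%N ->
  irrational alpha \/
  (exists (k : int) (p : nat),
     [/\ alpha = k%:~R / p%:R, prime p, coprimez k p%:Z, ~~ (p %| q)%N &
         forall s : nat, (0 < s)%N -> f (p ^ s)%N%:Z = chi (p ^ s)%N%:Z]) ->
  exists2 S : pred nat,
    (forall r s : nat, prime r -> S r -> (0 < s)%N ->
      f (r ^ s)%N%:Z = chi (r ^ s)%N%:Z) &
    forall Q : nat, (0 < Q)%N -> (forall t, prime t -> S t -> ~~ (t %| Q)%N) ->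
      expi2pi ((q * Q)%N%:R * alpha) != 1.
Proof.
move=> q0 [alpha_irr|[k [p [-> pp kp pq fp]]]].
  exists pred0 => // Q Q0 _; apply/eqP => /expi2pi_eq1[j /= jE].
  apply: alpha_irr; exists (j%:~R / (q * Q)%N%:R) => //.
  have qQ0 : (q * Q)%N%:R != 0 :> R by rewrite pnatr_eq0 -lt0n muln_gt0 q0.
  by rewrite fmorph_div/= ratr_int ratr_nat -jE mulrC mulKf.
exists (pred1 p) => [r s _ /eqP->|Q Q0 SQ]; first exact: fp.
apply/eqP => /expi2pi_eq1[j jE].
have p0 : p%:R != 0 :> R by rewrite pnatr_eq0 -lt0n prime_gt0.
have : (q * Q)%N%:Z * k = j * p%:Z.
  apply: (@intr_inj R) => /=.
  by rewrite !intrM -jE -mulrA divfK.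
move=> /(congr1 absz); rewrite !abszM !absz_nat => e.
have : (p %| q * Q * `|k|)%N by rewrite e dvdn_mull.
rewrite Gauss_dvdl; last by rewrite coprime_sym -[p]absz_nat -coprimezE.
by rewrite Euclid_dvdM// (negbTE pq) (negbTE (SQ p pp (eqxx p))).
Qed.

Section Conjugates.

Variable R : realType.

Definition conj_if (b : bool) (z : R[i]) : R[i] := if b then z^* else z.

Lemma normc_conj_if b z : normc (conj_if b z) = normc z.
Proof. by case: b => //; rewrite normcJ. Qed.

Lemma conj_ifB b z w : conj_if b z - conj_if b w = conj_if b (z - w).
Proof. by case: b; rewrite //= rmorphB. Qed.

Lemma conj_ifM b z w : conj_if b (z * w) = conj_if b z * conj_if b w.
Proof. by case: b; rewrite //= rmorphM. Qed.

End Conjugates.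

Theorem theorem2p13 (R : realType) (f chi : int -> R[i]) (q : nat) (alpha : R)
  (f_bounded : bounded_by_one f)
  (f_mult : multiplicative_fun f)
  (chi_prim : primitive_character q chi)
  (f_chi : pretends_to_be f chi)
  (h_alpha :
     irrational alpha \/
     exists (k : int) (p : nat),
       [/\ alpha = k%:~R / p%:R, prime p, coprimez k p%:Z, ~~ (p %| q)%N &
           forall s : nat, (0 < s)%N -> f (p ^ s)%N%:Z = chi (p ^ s)%N%:Z])
  (l : nat) (l_gt0 : (0 < l)%N) (shift : 'I_l -> int)
  (fs : 'I_l -> int -> R[i])
  (fsE : forall j, fs j = f \/ fs j = (fun n => (f n)^*)) :
  (fun N : nat =>
     average N (fun n : nat =>
       expi2pi (n%:R * alpha) * \prod_(j < l) fs j (n%:Z + shift j)))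
    @ \oo --> (0 : R[i]^o).
Proof.
have [chiP _] := chi_prim; have [q0 _ _ _] := chiP.
have f1 n : normc (f n) <= 1 by exact: bounded_normc.
have [S fS nonres] := nonresonant_period q0 h_alpha.
pose b j := `[< fs j <> f >].
have fsbE j n : fs j n = conj_if (b j) (f n).
  rewrite /b; case: asboolP => [|/contrapT->//].
  by case: (fsE j) => ->.
apply/(@cvgrPdist_lt R[i] R[i]^o) => -[e e'] /=; rewrite ltcE /= => /andP[/eqP-> e0].
have l0 : 0 < l%:R :> R by rewrite ltr0n.
pose d := e / (2 * l%:R); have d0 : 0 < d by rewrite divr_gt0// mulr_gt0.
have [Q [Q0 SQ] approx] := pretentious_approximation chiP f_mult f1 fS f_chi d0.
pose M := (q * Q)%N.
pose gap := normc (expi2pi (M%:R * alpha) - 1).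
have gap0 : 0 < gap.
  rewrite lt_neqAle normc_ge0 andbT eq_sym; apply/eqP => /eq0_normc /eqP.
  by rewrite subr_eq0; apply/negP; exact: nonres.
pose P j n := conj_if (b j) (model f chi Q n).
pose G n := \prod_(j < l) P j (n + shift j).
have model1 n : normc (model f chi Q n) <= 1 := normc_model_le1 chiP f1 Q n.
have P1 j n : normc (P j n) <= 1 by rewrite normc_conj_if.
have G1 n : normc (G n) <= 1 by exact: normc_prod_le1.
have GM n : G (n + M%:Z) = G n.
  by apply: eq_bigr => j _; rewrite /P addrAC (model_periodic f chiP).
(* [D] collects the costs that stay bounded as [N] grows: moving the window of
   summation by each shift, and the exponential sum of the periodic part. *)
pose D := \sum_(j < l) `|shift j|%N%:R * 2 + 2 * M%:R / gap.
have D0 : 0 <= D.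
  by rewrite addr_ge0 ?sumr_ge0// ?divr_ge0 ?mulr_ge0// ltW.
pose a n := expi2pi (n%:R * alpha) * \prod_(j < l) fs j (n%:Z + shift j).
have main N : normc (\sum_(1 <= n < N.+1) a n) <= e / 2 * N%:R + D.
  have [c c1 cE] := approx N.
  pose C := \prod_(j < l) conj_if (b j) c.
  have C1 : normc C <= 1.
    by apply: normc_prod_le1 => j; rewrite normc_conj_if.
  pose E n := normc (f n - c * model f chi Q n).
  have E2 n : 0 <= E n <= 2.
    rewrite normc_ge0 (le_trans (le_normcD _ _))// normcN normcM -[2]natr1 lerD//.
    by rewrite mulr_ile1 ?normc_ge0.
  have err n : normc (a n - C * (expi2pi (n%:R * alpha) * G n%:Z))
      <= \sum_(j < l) E (n%:Z + shift j).
    rewrite mulrCA -mulrBr normcM expi2pi_cis normc_cis mul1r -big_split /=.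
    apply: le_trans (normc_prod_dist _ _ _ _) _ => [j|j|].
    - by rewrite fsbE normc_conj_if.
    - by rewrite normcM mulr_ile1 ?normc_ge0// normc_conj_if.
    - by apply: ler_sum => j _; rewrite fsbE -conj_ifM conj_ifB normc_conj_if.
  rewrite -[X in normc X](subrK (\sum_(1 <= n < N.+1)
    C * (expi2pi (n%:R * alpha) * G n%:Z))) -sumrB.
  apply: le_trans (le_normcD _ _) _; rewrite /D addrA; apply: lerD.
    apply: le_trans (normc_sum _ _ _) _.
    apply: (@le_trans _ _ (\sum_(1 <= n < N.+1) \sum_(j < l) E (n%:Z + shift j))).
      by apply: ler_sum => n _; exact: err.
    rewrite exchange_big /=.
    apply: (@le_trans _ _ (\sum_(j < l) (d * N%:R + `|shift j|%N%:R * 2))).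
      apply: ler_sum => j _; apply: le_trans (sum_shift_le N _ E2) _.
      by rewrite lerD2r.
    rewrite big_split /= lerD2r sumr_const card_ord -mulr_natr.
    by rewrite le_eqVlt; apply/orP; left; apply/eqP; rewrite /d; field; rewrite lt0r_neq0.
  rewrite -mulr_sumr normcM (le_trans (ler_piMl _ C1)) ?normc_ge0//.
  rewrite ler_pdivlMr// mulrC; exact: periodic_exponential_sum_le.
have [N0 N0D] := natr_archi (2 * D / e).
near=> N.
have N_gt0 : 0 < N%:R :> R by rewrite ltr0n; near: N; exists 1%N.
have N0N : (N0 < N)%N by near: N; exists N0.+1.
rewrite sub0r normrN normc_norm -[X in _ < X]/(e%:C) ltcR /average normcM normcV.
have -> : normc N%:R = N%:R :> R.
  by apply: complexI; rewrite -normc_norm normr_nat rmorph_nat.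
rewrite mulrC ltr_pdivrMr//; apply: le_lt_trans (main N) _.
move: N0D; rewrite ler_pdivrMr// => N0D.
have : N0%:R * e < N%:R * e by rewrite ltr_pM2r// ltr_nat.
lra.
Unshelve. all: by end_near. Qed.
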